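(* Let $\mathcal M$ be the collection of all pairs of probability distributions on $\mathbb R$. Then for any trade-off functions $f_0$ and $f_1$ with $f_1(0)>0$, any $n\geq1$, and any test $\psi=\psi(X_{1:n},Y_{1:n})$, $$\mathrm{Err}_{\mathrm I}(\mathcal M;\psi)+\mathrm{Err}_{\mathrm{II}}(\mathcal M;\psi)\geq1 .$$
   Context: Trade-off functions: for probability distributions $P,Q$ on $\mathbb R$, $T(P,Q)(\alpha)=\inf\{E_Q[1-\varphi]:\ \varphi:\mathbb R\to[0,1]\text{ measurable},\ E_P[\varphi]\leq\alpha\}$, $\alpha\in[0,1]$. A trade-off function is a convex, continuous, non-increasing $f:[0,1]\to[0,1]$ with $f(\alpha)\leq1-\alpha$ for all $\alpha\in[0,1]$. $f\succeq g$ means $f(\alpha)\geq g(\alpha)$ for all $\alpha\in[0,1]$; $f\not\succeq g$ means $f(\alpha_0)<g(\alpha_0)$ for some $\alpha_0\in[0,1]$. Testing: $X_{1:n}\sim P^n$ and $Y_{1:n}\sim Q^n$ independent; for a test $\psi$ (a measurable $[0,1]$-valued function of the data, value $1$ = rejection), $(P^n\times Q^n)(\psi)$ is its expectation, and $\mathrm{Err}_{\mathrm I}(\mathcal M;\psi)=\sup_{(P,Q)\in\mathcal M:\,T(P,Q)\succeq f_0}(P^n\times Q^n)(\psi)$, $\mathrm{Err}_{\mathrm{II}}(\mathcal M;\psi)=\sup_{(P,Q)\in\mathcal M:\,T(P,Q)\not\succeq f_1}(P^n\times Q^n)(1-\psi)$. *)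

(* Defs.v *)
From HB Require Import structures.
From mathcomp Require Import all_boot all_order all_algebra.
From mathcomp Require Import all_classical all_reals all_analysis.

Set Implicit Arguments.
Unset Strict Implicit.
Unset Printing Implicit Defensive.

Import Order.TTheory GRing.Theory Num.Theory.
Import numFieldNormedType.Exports.

Local Open Scope classical_set_scope.
Local Open Scope ring_scope.

(* The cons map, through which the product measure on T * T^n is transported
   to T^n.+1. *)
Definition tuple_cons (d : measure_display) (T : measurableType d) (n : nat)
    (p : T * n.-tuple T) : n.+1.-tuple T := [tuple of p.1 :: p.2].

Lemma measurable_tuple_cons (d : measure_display) (T : measurableType d)
    (n : nat) : measurable_fun [set: T * n.-tuple T] (@tuple_cons d T n).
Proof. exact: measurable_cons. Qed.

HB.instance Definition _ (d : measure_display) (T : measurableType d)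
    (n : nat) := isMeasurableFun.Build _ _ _ _ (@tuple_cons d T n)
  (@measurable_tuple_cons d T n).

(* The n-fold product P^n, defined by recursion as the library has only binary
   product measures; iid_box characterizes it on measurable boxes. *)
Fixpoint iid (d : measure_display) (T : measurableType d) (R : realType)
    (P : probability T R) (n : nat) : probability (n.-tuple T) R :=
  match n return probability (n.-tuple T) R with
  | 0 => \d_([tuple] : 0.-tuple T)
  | m.+1 => distribution (P \x iid P m)%E (@tuple_cons d T m)
  end.

Lemma iid_box (d : measure_display) (T : measurableType d) (R : realType)
    (P : probability T R) (n : nat) (A : 'I_n -> set T) :
  (forall i, measurable (A i)) ->
  iid P n [set x | forall i, A i (tnth x i)] = (\prod_(i < n) P (A i))%E.
Proof.
elim: n A => [|n IH] A mA.
  rewrite big_ord0 /= diracE mem_set//=; by case.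
rewrite big_ord_recl -IH// -product_measure1E//=; last first.
  rewrite [X in measurable X](_ : _ = \bigcap_(i in [set: 'I_n])
      ((@tnth n T)^~ i @^-1` A (lift ord0 i))).
    apply: fin_bigcap_measurable => [|i _]; first exact: finite_finset.
    by rewrite -[X in measurable X]setTI; apply: measurable_tnth.
  by apply/seteqP; split=> x /= h i; [move=> _|]; exact: h.
congr (_ _); apply/seteqP; split=> -[a x] /=.
  move=> h; split; first by have := h ord0; rewrite (tnth_nth a).
  by move=> i; have := h (lift ord0 i); rewrite tnthS.
case=> Aa h i; have [j ->|->] := unliftP ord0 i; first by rewrite tnthS.
by rewrite (tnth_nth a).
Qed.

Definition is_test (d : measure_display) (T : measurableType d) (R : realType)
    (phi : T -> R) : Prop :=
  measurable_fun [set: T] phi /\ forall x, 0 <= phi x <= 1.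

Definition tradeoff (R : realType) (P Q : probability R R) (a : R) : \bar R :=
  ereal_inf [set ('E_Q[fun x => (1 - phi x)%R])%E | phi in
    [set phi : R -> R | is_test phi /\ ('E_P[phi] <= a%:E)%E]].

(* Trade-off functions live on [0, 1]; they are represented by total functions
   on R whose values outside [0, 1] are never used. *)
Definition is_tradeoff (R : realType) (f : R -> R) : Prop :=
  [/\ {in `[0, 1], forall a, 0 <= f a <= 1},
      convex_function (`[0, 1]%classic : set R) f,
      {within `[0, 1], continuous f},
      {in `[0, 1] &, {homo f : a b / a <= b >-> b <= a}} &
      {in `[0, 1], forall a, f a <= 1 - a}].

Definition dominates (R : realType) (f g : R -> \bar R) : Prop :=
  {in `[0, 1], forall a, (g a <= f a)%E}.

Definition not_dominates (R : realType) (f g : R -> \bar R) : Prop :=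
  exists2 a : R, a \in `[0, 1] & (f a < g a)%E.

Definition ErrI (R : realType) (f0 : R -> R)
    (M : set (probability R R * probability R R)) (n : nat)
    (psi : n.-tuple R * n.-tuple R -> R) : \bar R :=
  ereal_sup [set ('E_(iid PQ.1 n \x iid PQ.2 n)[psi])%E | PQ in
    [set PQ | M PQ /\ dominates (tradeoff PQ.1 PQ.2) (EFin \o f0)]].

Definition ErrII (R : realType) (f1 : R -> R)
    (M : set (probability R R * probability R R)) (n : nat)
    (psi : n.-tuple R * n.-tuple R -> R) : \bar R :=
  ereal_sup [set ('E_(iid PQ.1 n \x iid PQ.2 n)[fun z => (1 - psi z)%R])%E | PQ in
    [set PQ | M PQ /\ not_dominates (tradeoff PQ.1 PQ.2) (EFin \o f1)]].

(* Main.v *)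
Require Import Defs.
From mathcomp Require Import all_boot all_order all_algebra.
From mathcomp Require Import all_classical all_reals all_analysis.
From mathcomp Require Import measurable_realfun zify ring lra.

Import Order.TTheory GRing.Theory Num.Theory.
Import numFieldNormedType.Exports.

(** The two hypotheses cannot be told apart because a law spread over many
atoms looks, through a sample of fixed size, like a pair of mutually singular
laws.

Take the 2^m subsets of {0, ..., m-1}, encoded as distinct reals, as atoms, and
let U be uniform on them.  The pair (U, U) satisfies T(U, U)(a) >= 1 - a >=
f0 a, so it belongs to the null hypothesis.  For each k < m, let P_k be uniform
on the subsets that avoid k and Q_k uniform on those that contain k.  The
supports are disjoint, so T(P_k, Q_k)(0) = 0 < f1 0, and every (P_k, Q_k)
belongs to the alternative ([halves_exist], [tradeoff0_le0]).

Let L_k be the likelihood ratio of P_k^n x Q_k^n against U^n x U^n.  Since the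
events of avoiding k and of avoiding l are independent under U when k differs
from l, the integral of L_k L_l is 1 then, whereas the integral of L_k^2 is
4^n.  Thus the variance of the average of the L_k is at most 4^n / m: the
uniform mixture of the alternatives tends to U^n x U^n as m grows, and an upper
bound on the expectation of 1 - psi under all the alternatives carries over to
U^n x U^n up to an arbitrarily small error ([second_moment_bound],
[null_close_to_alternatives]).  As psi and 1 - psi have total expectation 1
under U^n x U^n, the two error suprema add up to at least 1. *)

Local Open Scope classical_set_scope.
Local Open Scope ring_scope.

(** * Densities and product measures *)

(** The change of measure is required directly for all nonnegative measurable
functions, rather than for sets, because this is the form that Tonelli's theorem
propagates to products. *)
Definition has_density {d} {T : measurableType d} {R : realType}
    (P U : {measure set T -> \bar R}) (g : T -> R) : Prop :=
  [/\ measurable_fun [set: T] g, (forall x, 0 <= g x) &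
      forall f : T -> \bar R, measurable_fun [set: T] f ->
        (forall x, 0 <= f x)%E ->
        (\int[P]_x f x = \int[U]_x ((g x)%:E * f x))%E].

(** Tonelli's theorem on both sides, the inner integral being changed from P2
to U2 at each fixed first coordinate. *)
Lemma has_density_prod {d1 d2} {T1 : measurableType d1} {T2 : measurableType d2}
    {R : realType} {P1 U1 : probability T1 R} {P2 U2 : probability T2 R}
    {g1 : T1 -> R} {g2 : T2 -> R} :
  has_density P1 U1 g1 -> has_density P2 U2 g2 ->
  has_density (P1 \x P2)%E (U1 \x U2)%E (fun z => g1 z.1 * g2 z.2).
Proof.
move=> [mg1 g1_ge0 P1E] [mg2 g2_ge0 P2E].
have mg : measurable_fun setT (fun z : T1 * T2 => g1 z.1 * g2 z.2).
  by apply: measurable_funM; apply: measurableT_comp.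
split=> [//|z|f mf f_ge0]; first exact: mulr_ge0.
rewrite fubini_tonelli1// fubini_tonelli1//=; last 2 first.
- by apply: emeasurable_funM => //; exact/measurable_EFinP.
- by move=> z; rewrite mule_ge0// lee_fin mulr_ge0.
rewrite P1E; last 2 first.
- exact: measurable_fun_fubini_tonelli_F.
- by move=> x; apply: integral_ge0.
apply: eq_integral => x _ /=; rewrite /fubini_F.
have mfx : measurable_fun setT (fun y => f (x, y)) by exact: measurableT_comp.
rewrite P2E// -ge0_integralZl//=.
- by apply: eq_integral => y _; rewrite EFinM muleA.
- by apply: emeasurable_funM => //; exact/measurable_EFinP.
- by move=> y _; rewrite mule_ge0// lee_fin.
- by rewrite lee_fin.
Qed.

Lemma measurable_tuple_prod {d} {T : measurableType d} {R : realType}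
    (g : T -> R) n : measurable_fun [set: T] g ->
  measurable_fun [set: n.-tuple T] (fun t => \prod_(i < n) g (tnth t i)).
Proof.
move=> mg; apply: measurable_prod => i _.
by apply: measurableT_comp => //; exact: measurable_tnth.
Qed.

Lemma prod_tuple_cons {d} {T : measurableType d} {R : realType}
    (g : T -> R) n (p : T * n.-tuple T) :
  \prod_(i < n.+1) g (tnth (tuple_cons p) i) =
  g p.1 * \prod_(i < n) g (tnth p.2 i).
Proof.
rewrite big_ord_recl; congr (_ * _).
by apply: eq_bigr => i _; rewrite /tuple_cons tnthS.
Qed.

Lemma ge0_integral_iidS {d} {T : measurableType d} {R : realType}
    (P : probability T R) {n} (f : n.+1.-tuple T -> \bar R) :
  measurable_fun [set: n.+1.-tuple T] f -> (forall t, 0 <= f t)%E ->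
  (\int[iid P n.+1]_t f t = \int[P \x iid P n]_p f (tuple_cons p))%E.
Proof. by move=> mf f_ge0; rewrite ge0_integral_distribution. Qed.

(** The likelihood ratio of a sample is the product of the ratios of its
entries. *)
Lemma has_density_iid {d} {T : measurableType d} {R : realType}
    {P U : probability T R} {g : T -> R} n : has_density P U g ->
  has_density (iid P n) (iid U n) (fun t => \prod_(i < n) g (tnth t i)).
Proof.
move=> dg; have [mg g_ge0 _] := dg.
elim: n => [|n IHn].
  split=> [|t|f mf f_ge0]; first exact: measurable_tuple_prod.
    by rewrite prodr_ge0.
  by apply: eq_integral => t _; rewrite big_ord0 mul1e.
have [_ _ PE] := has_density_prod dg IHn.
split=> [|t|f mf f_ge0]; first exact: measurable_tuple_prod.
  by rewrite prodr_ge0.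
rewrite !ge0_integral_iidS//; last 2 first.
- apply: emeasurable_funM => //; apply/measurable_EFinP.
  exact: measurable_tuple_prod.
- by move=> t; rewrite mule_ge0// lee_fin prodr_ge0.
rewrite PE//; last exact: measurableT_comp.
by apply: eq_integral => p _; rewrite prod_tuple_cons.
Qed.

Lemma integral_prodM {d1 d2} {T1 : measurableType d1} {T2 : measurableType d2}
    {R : realType} {P1 : probability T1 R} {P2 : probability T2 R}
    {g1 : T1 -> R} {g2 : T2 -> R} {a b : R} :
  measurable_fun [set: T1] g1 -> measurable_fun [set: T2] g2 ->
  (forall x, 0 <= g1 x) -> (forall x, 0 <= g2 x) ->
  (\int[P1]_x (g1 x)%:E = a%:E)%E -> (\int[P2]_x (g2 x)%:E = b%:E)%E ->
  (\int[P1 \x P2]_z (g1 z.1 * g2 z.2)%:E = (a * b)%:E)%E.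
Proof.
move=> mg1 mg2 g1_ge0 g2_ge0 Ea Eb.
rewrite fubini_tonelli1//=; last 2 first.
- apply/measurable_EFinP.
  by apply: measurable_funM; apply: measurableT_comp.
- by move=> z; rewrite lee_fin mulr_ge0.
transitivity (\int[P1]_x ((g1 x)%:E * b%:E))%E.
  apply: eq_integral => x _; rewrite /fubini_F /=.
  under eq_integral do rewrite EFinM.
  rewrite ge0_integralZl ?Eb ?lee_fin//; first exact/measurable_EFinP.
  by move=> y _; rewrite lee_fin.
rewrite EFinM -Ea; under eq_integral do rewrite muleC.
rewrite ge0_integralZl; first by rewrite muleC.
- by [].
- exact/measurable_EFinP.
- by move=> y _; rewrite lee_fin.
- by rewrite -Eb; apply: integral_ge0 => y _; rewrite lee_fin.
Qed.

Lemma integral_iid_prod {d} {T : measurableType d} {R : realType}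
    {P : probability T R} {g : T -> R} {a : R} {n} :
  measurable_fun [set: T] g -> (forall x, 0 <= g x) ->
  (\int[P]_x (g x)%:E = a%:E)%E ->
  (\int[iid P n]_t (\prod_(i < n) g (tnth t i))%:E = (a ^+ n)%:E)%E.
Proof.
move=> mg g_ge0 Ea.
elim: n => [|n IHn].
  under eq_integral do rewrite big_ord0.
  by rewrite integral_cst//= diracT mul1e.
rewrite ge0_integral_iidS; last 2 first.
- by apply/measurable_EFinP; exact: measurable_tuple_prod.
- by move=> t; rewrite lee_fin prodr_ge0.
under eq_integral do rewrite prod_tuple_cons.
rewrite exprS (integral_prodM _ _ _ _ Ea IHn)//.
- exact: measurable_tuple_prod.
- by move=> t; rewrite prodr_ge0.
Qed.

(** * Tests and the second moment bound *)

Lemma ge0_integral_linear {d} {T : measurableType d} {R : realType}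
    (U : probability T R) (a c : R) (f g : T -> R) :
  0 <= a -> 0 <= c ->
  measurable_fun [set: T] f -> (forall x, 0 <= f x) ->
  measurable_fun [set: T] g -> (forall x, 0 <= g x) ->
  (\int[U]_x (a * f x + c * g x)%:E =
   a%:E * \int[U]_x (f x)%:E + c%:E * \int[U]_x (g x)%:E)%E.
Proof.
move=> a_ge0 c_ge0 mf f_ge0 mg g_ge0.
under eq_integral do rewrite EFinD !EFinM.
have mEf : measurable_fun setT (EFin \o f) by exact/measurable_EFinP.
have mEg : measurable_fun setT (EFin \o g) by exact/measurable_EFinP.
rewrite ge0_integralD//.
- by rewrite !ge0_integralZl// => x _; rewrite lee_fin.
- by move=> x _; rewrite mule_ge0// lee_fin.
- exact: measurable_funeM.
- by move=> x _; rewrite mule_ge0// lee_fin.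
- exact: measurable_funeM.
Qed.

Lemma test_integral_compl {d} {T : measurableType d} {R : realType}
    (U : probability T R) {phi : T -> R} : is_test phi ->
  (\int[U]_x (phi x)%:E + \int[U]_x (1 - phi x)%:E = 1)%E.
Proof.
move=> [mphi phi01].
rewrite -ge0_integralD//.
- under eq_integral do rewrite -EFinD addrC subrK.
  by rewrite integral_cst//= probability_setT mule1.
- by move=> x _; rewrite lee_fin; case/andP: (phi01 x).
- exact/measurable_EFinP.
- by move=> x _; rewrite lee_fin subr_ge0; case/andP: (phi01 x).
- by apply/measurable_EFinP; exact: measurable_funB.
Qed.

Lemma test_compl {d} {T : measurableType d} {R : realType} {phi : T -> R} :
  is_test phi -> is_test (fun x => 1 - phi x).
Proof.
move=> [mphi phi01]; split; first exact: measurable_funB.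
by move=> x; have /andP[? ?] := phi01 x; apply/andP; split; lra.
Qed.

Lemma test_integral_ge0 {d} {T : measurableType d} {R : realType}
    (U : probability T R) {phi : T -> R} : is_test phi ->
  (0 <= \int[U]_x (phi x)%:E)%E.
Proof.
move=> [_ phi01]; apply: integral_ge0 => x _.
by rewrite lee_fin; case/andP: (phi01 x).
Qed.

Lemma test_integral_le1 {d} {T : measurableType d} {R : realType}
    (U : probability T R) {phi : T -> R} : is_test phi ->
  (\int[U]_x (phi x)%:E <= 1)%E.
Proof.
move=> tphi; rewrite -(test_integral_compl U tphi) leeDl//.
exact/test_integral_ge0/test_compl.
Qed.

Lemma test_integral_fin_num {d} {T : measurableType d} {R : realType}
    (U : probability T R) {phi : T -> R} : is_test phi ->
  (\int[U]_x (phi x)%:E)%E \is a fin_num.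
Proof.
move=> tphi; rewrite ge0_fin_numE ?test_integral_ge0//.
by rewrite (le_lt_trans (test_integral_le1 U tphi))// ltry.
Qed.

(** In this section the likelihood ratios L_k of finitely many laws P_k with
respect to one law U have sum S; comparing the mean mixture of the P_k with U
amounts to comparing S with the constant m. *)
Section second_moment.
Context {d} {T : measurableType d} {R : realType} {m : nat}.
Context {U : probability T R} {P : 'I_m -> probability T R} {L : 'I_m -> T -> R}.
Hypothesis dP : forall k, has_density (P k) U (L k).

Let S x := \sum_(k < m) L k x.

Let mL k : measurable_fun [set: T] (L k). Proof. by have [] := dP k. Qed.

Let L_ge0 k x : 0 <= L k x. Proof. by have [] := dP k. Qed.

Let mS : measurable_fun [set: T] S. Proof. exact: measurable_sum. Qed.

Let S_ge0 x : 0 <= S x. Proof. exact: sumr_ge0. Qed.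

Lemma integral_sum_density (h : T -> R) :
  measurable_fun [set: T] h -> (forall x, 0 <= h x) ->
  (\int[U]_x (S x * h x)%:E = \sum_(k < m) \int[P k]_x (h x)%:E)%E.
Proof.
move=> mh h_ge0; under eq_integral do rewrite mulr_suml -sumEFin.
rewrite ge0_integral_sum//.
- apply: eq_bigr => k _; have [_ _ ->] := dP k.
  + by apply: eq_integral => x _; rewrite EFinM.
  + exact/measurable_EFinP.
  + by move=> x; rewrite lee_fin.
- by move=> k; apply/measurable_EFinP; exact: measurable_funM.
- by move=> k x _; rewrite lee_fin mulr_ge0.
Qed.

(** Let s be the average of the L_k.  A test phi satisfies
phi - s phi <= |1 - s| <= delta + (1 - s)^2 / (4 delta), where the integral of
s phi averages the integrals of phi under the P_k and the integral of (1 - s)^2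
is at most C / m because distinct L_k are orthogonal once centred.  The proof
clears the denominators and moves the negative terms to the other side, so that
only integrals of nonnegative functions occur. *)
Lemma second_moment_bound (C : R) (phi : T -> R) (b delta : R) :
  (0 < m)%N -> 0 < delta -> 0 <= C ->
  (forall k l, k != l -> \int[P k]_x (L l x)%:E = 1)%E ->
  (forall k, \int[P k]_x (L k x)%:E = C%:E)%E ->
  is_test phi -> (forall k, \int[P k]_x (phi x)%:E <= b%:E)%E ->
  (\int[U]_x (phi x)%:E <= (b + delta + C / (4 * m%:R * delta))%:E)%E.
Proof.
move=> m_gt0 delta_gt0 C_ge0 ort var [mphi phi01] phib.
have phi_ge0 x : 0 <= phi x by have /andP[] := phi01 x.
have phi_le1 x : phi x <= 1 by have /andP[] := phi01 x.
have IS : (\int[U]_x (S x)%:E = m%:R%:E)%E.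
  under eq_integral do rewrite -[S _]mulr1.
  rewrite integral_sum_density//.
  under eq_bigr do rewrite integral_cst//= probability_setT mule1.
  by rewrite sumEFin sumr_const card_ord.
have ISphi : (\int[U]_x (S x * phi x)%:E <= (m%:R * b)%:E)%E.
  rewrite integral_sum_density// (@le_trans _ _ (\sum_(k < m) b%:E)%E)//.
    exact: lee_sum.
  by rewrite sumEFin sumr_const card_ord mulr_natl.
have ISS : (\int[U]_x (S x * S x)%:E <= (m%:R * (m%:R + C))%:E)%E.
  rewrite integral_sum_density//.
  rewrite (@le_trans _ _ (\sum_(k < m) (m%:R + C)%:E)%E)//; last first.
    by rewrite sumEFin sumr_const card_ord mulr_natl.
  apply: lee_sum => k _.
  under eq_integral do rewrite -sumEFin.
  rewrite ge0_integral_sum//; last 2 first.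
  - by move=> l; exact/measurable_EFinP.
  - by move=> l x _; rewrite lee_fin.
  rewrite (bigD1 k)//= var addrC EFinD leeD2r//.
  rewrite (eq_bigr (fun=> 1%E)); last first.
    by move=> l lk; rewrite ort// eq_sym.
  rewrite (@le_trans _ _ (\sum_(l < m) 1)%E)//.
    by rewrite [leRHS](bigD1 k)//= leeDr.
  by rewrite sumEFin sumr_const card_ord.
have pw x : 4 * delta * m%:R ^+ 2 * phi x + 2 * m%:R * S x <=
    4 * delta * m%:R * (S x * phi x) +
    ((4 * delta ^+ 2 + 1) * m%:R ^+ 2 + S x * S x).
  (* Completing the square; what remains has the sign of 1 - phi^2. *)
  rewrite -subr_ge0 [leRHS](_ : _ = (2 * delta * m%:R - (m%:R - S x) * phi x) ^+ 2
      + (m%:R - S x) ^+ 2 * ((1 - phi x) * (1 + phi x))); last by ring.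
  rewrite addr_ge0 ?sqr_ge0// mulr_ge0 ?sqr_ge0// mulr_ge0 ?subr_ge0//.
  by rewrite addr_ge0.
have mSphi : measurable_fun setT (fun x => S x * phi x) by exact: measurable_funM.
have mSS : measurable_fun setT (fun x => S x * S x) by exact: measurable_funM.
pose c : R := (4 * delta ^+ 2 + 1) * m%:R ^+ 2.
(* The factors 1 give h the two-term shape of [ge0_integral_linear]. *)
pose h x := c * 1 + 1 * (S x * S x).
have c_ge0 : 0 <= c.
  by rewrite mulr_ge0 ?sqr_ge0// addr_ge0// mulr_ge0// sqr_ge0.
have mh : measurable_fun setT h.
  by apply: measurable_funD; exact: measurable_funM.
have h_ge0 x : 0 <= h x by rewrite /h mulr1 mul1r addr_ge0// mulr_ge0.
have a_ge0 : 0 <= 4 * delta * m%:R by rewrite mulr_ge0// mulr_ge0// ltW.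
have a2_ge0 : 0 <= 4 * delta * m%:R ^+ 2 by rewrite exprS mulrA mulr_ge0.
have Ih : (\int[U]_x (h x)%:E <= (c + m%:R * (m%:R + C))%:E)%E.
  rewrite ge0_integral_linear//; last by move=> x; rewrite mulr_ge0.
  rewrite integral_cst//= probability_setT !mule1 mul1e EFinD.
  by rewrite leeD2l.
have : (\int[U]_x (4 * delta * m%:R ^+ 2 * phi x + 2 * m%:R * S x)%:E <=
    \int[U]_x (4 * delta * m%:R * (S x * phi x) + 1 * h x)%:E)%E.
  apply: ge0_le_integral => //.
  - by move=> x _; rewrite lee_fin addr_ge0// !mulr_ge0// ltW.
  - by apply/measurable_EFinP; apply: measurable_funD; exact: measurable_funM.
  - by apply/measurable_EFinP; apply: measurable_funD; exact: measurable_funM.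
  - by move=> x _; rewrite lee_fin /h mulr1 !mul1r.
rewrite [leLHS]ge0_integral_linear//.
rewrite [leRHS]ge0_integral_linear//; last by move=> x; rewrite mulr_ge0.
rewrite IS mul1e => le1.
have Ea_ge0 : (0 <= (4 * delta * m%:R)%:E)%E by rewrite lee_fin.
have {}le1 := le_trans le1 (leeD (lee_wpmul2l Ea_ge0 ISphi) Ih).
have phi_fin : (\int[U]_x (phi x)%:E)%E \is a fin_num.
  exact: test_integral_fin_num.
move: le1; rewrite -(fineK phi_fin); set Phi := fine _.
rewrite -!EFinM -!EFinD !lee_fin => le1.
have m0 : 0 < m%:R :> R by rewrite ltr0n.
have a2_gt0 : 0 < 4 * delta * m%:R ^+ 2.
  by rewrite !mulr_gt0// exprn_gt0.
rewrite /c in le1; rewrite -(ler_pM2l a2_gt0).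
rewrite [leRHS](_ : _ = 4 * delta * m%:R ^+ 2 * b + 4 * delta ^+ 2 * m%:R ^+ 2 +
   m%:R * C); first by lra.
by field; rewrite ?gt_eqF.
Qed.

End second_moment.

(** * Uniform laws on finite sets of atoms *)

(** The law of e a for a uniform in E, given by its integrals because these are
what the densities and likelihood computations use. *)
Definition uniform_law {d} {T : measurableType d} {R : realType} {I : finType}
    (e : I -> T) (E : {set I}) (P : {measure set T -> \bar R}) : Prop :=
  forall f : T -> \bar R, measurable_fun [set: T] f -> (forall x, 0 <= f x)%E ->
    (\int[P]_x f x = (#|E|%:R^-1)%:E * \sum_(a in E) f (e a))%E.

(** The law is the normalized counting measure of the atoms; the probability
that the normalization takes as a default for degenerate masses is never
reached, the mass being #|E| > 0. *)
Lemma uniform_law_exists {d} {T : measurableType d} {R : realType}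
    {I : finType} (e : I -> T) (E : {set I}) :
  (0 < #|E|)%N -> exists P : probability T R, uniform_law e E P.
Proof.
move=> E_gt0; have /card_gt0P[a0 _] := E_gt0.
pose m : {measure set T -> \bar R} :=
  msum (fun i => \d_(e (nth a0 (enum E) i))) #|E|.
have mT : m setT = #|E|%:R%:E.
  rewrite /m /= /msum; under eq_bigr do rewrite /= diracT.
  by rewrite sumEFin sumr_const card_ord.
exists (mnormalize m (\d_(e a0))) => f mf f_ge0.
have w_ge0 : 0 <= #|E|%:R^-1 :> R by rewrite invr_ge0.
rewrite (eq_measure_integral (mscale (NngNum w_ge0) m)); last first.
  move=> A _ _; rewrite /= /mnormalize ifF; first by rewrite [m setT]mT [LHS]muleC.
  by rewrite [m setT]mT orbF eqe pnatr_eq0 gtn_eqF.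
rewrite ge0_integral_mscale//= ge0_integral_measure_sum//; congr (_ * _)%E.
transitivity (\sum_(i < #|E|) f (e (nth a0 (enum E) i)))%E.
  apply: eq_bigr => i _.
  by apply: etrans (integral_dirac _ measurableT mf) _; rewrite diracT mul1e.
by rewrite -[RHS]big_enum [RHS](big_nth a0) big_mkord cardE.
Qed.

Lemma indic_preimage {T I : Type} {R : realType} {e : I -> T} {D : set T}
    {b : pred I} (a : I) :
  (forall a, D (e a) <-> b a) -> \1_D (e a) = (b a)%:R :> R.
Proof.
move=> De; rewrite indicE; congr (nat_of_bool _)%:R.
by apply/idP/idP => [/set_mem/De|/De/mem_set].
Qed.

(** Halving the set of atoms doubles the mass of those that are kept. *)
Lemma has_density_uniform_law {d} {T : measurableType d} {R : realType}
    {I : finType} {e : I -> T} {E : {set I}} {P U : probability T R} {D : set T} :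
  measurable D -> (forall a, D (e a) <-> a \in E) ->
  (2 * #|E| = #|I|)%N -> (0 < #|E|)%N ->
  uniform_law e E P -> uniform_law e [set: I]%SET U ->
  has_density P U (fun x => 2 * \1_D x).
Proof.
move=> mD De cE E_gt0 PE UE.
have mg : measurable_fun setT (fun x : T => 2 * \1_D x : R).
  exact: measurable_funM.
split=> [//|x|f mf f_ge0]; first by rewrite mulr_ge0.
rewrite PE// UE//; last 2 first.
- by apply: emeasurable_funM => //; exact/measurable_EFinP.
- by move=> x; rewrite mule_ge0// lee_fin mulr_ge0.
rewrite cardsT -cE natrM invfM mulrC EFinM -muleA; congr (_ * _)%E.
rewrite [in RHS](eq_bigl xpredT); last by move=> a; rewrite inE.
rewrite [in RHS](eq_bigr (fun a => 2%:E * (if a \in E then f (e a) else 0)))%E.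
  rewrite -ge0_sume_distrr; last by move=> a _; case: ifP.
  by rewrite [LHS]big_mkcond/= muleA -EFinM mulVf ?pnatr_eq0// mul1e.
move=> a _; rewrite (indic_preimage (b := mem E))//=.
by case: ifPn => _; rewrite ?mulr1// mulr0 mul0e mule0.
Qed.

Lemma integral_uniform_law_indic {d} {T : measurableType d} {R : realType}
    {I : finType} {e : I -> T} {E F : {set I}} {P : probability T R} {D : set T} :
  measurable D -> (forall a, D (e a) <-> a \in F) -> uniform_law e E P ->
  (\int[P]_x (2 * \1_D x)%:E = (2 * #|E :&: F|%:R / #|E|%:R)%:E)%E.
Proof.
move=> mD De PE; rewrite PE; last 2 first.
- by apply/measurable_EFinP; exact: measurable_funM.
- by move=> x; rewrite lee_fin mulr_ge0.
under eq_bigr do rewrite (indic_preimage (b := mem F))//.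
rewrite sumEFin -EFinM -big_distrr/= mulrC; congr (_ * _)%:E.
rewrite (big_setID F)/= [X in _ + X]big1 ?addr0; last first.
  by move=> a; rewrite inE => /andP[/negbTE aF _]; rewrite /= aF.
rewrite (eq_bigr (fun=> 1)) ?sumr_const//.
by move=> a; rewrite inE => /andP[_ aF]; rewrite /= aF.
Qed.

(** * Disjoint alternatives from pairwise independent halves *)

Definition avoiding {m} (k : 'I_m) : {set {set 'I_m}} := powerset [set~ k].

Lemma card_avoiding {m} (k : 'I_m) : (2 * #|avoiding k| = #|{set 'I_m}|)%N.
Proof.
have -> : #|{set 'I_m}| = (2 ^ m)%N.
  by rewrite -cardsT -powersetT card_powerset cardsT card_ord.
rewrite card_powerset cardsCs finset.setCK cards1 card_ord -expnS subn1 prednK//.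
exact: leq_trans (ltn_ord k).
Qed.

(** Together with [card_avoiding], this says that avoiding k and avoiding l are
independent events of probability 1/2 for a uniform random subset. *)
Lemma card_avoidingI {m} {k l : 'I_m} : k != l ->
  (2 * #|avoiding k :&: avoiding l| = #|avoiding k|)%N.
Proof.
move=> kl; have -> : avoiding k :&: avoiding l = powerset (~: [set k; l]).
  by apply/setP => S; rewrite !inE finset.setCU finset.subsetI.
have := max_card (mem [set k; l]%SET); rewrite cards2 kl card_ord => m_ge2.
rewrite !card_powerset !cardsC1 card_ord cardsCs finset.setCK cards2 kl card_ord.
by rewrite -expnS; congr (2 ^ _)%N; lia.
Qed.

Lemma card_avoidingC {m} (k : 'I_m) :
  (2 * #|~: avoiding k| = #|{set 'I_m}|)%N.
Proof. by have := cardsC (avoiding k); rewrite -(card_avoiding k); lia. Qed.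

Lemma card_avoidingCI {m} (k l : 'I_m) : k != l ->
  (2 * #|~: avoiding k :&: ~: avoiding l| = #|~: avoiding k|)%N.
Proof.
move=> kl; rewrite -finset.setCU.
have := cardsUI (avoiding k) (avoiding l).
have := cardsC (avoiding k :|: avoiding l); have := cardsC (avoiding k).
have : (2 * #|avoiding l| = 2 * #|avoiding k|)%N by rewrite !card_avoiding.
by rewrite -(card_avoiding k); have := card_avoidingI kl; lia.
Qed.

(** The value at k, l is the integral of the likelihood ratio of the l-th half
under the uniform law on the k-th half: 2 on the diagonal, 1 off it. *)
Lemma half_overlaps {m} {R : realType} {I : finType} {E : 'I_m -> {set I}} :
  (forall k, 0 < #|E k|)%N ->
  (forall k l, k != l -> 2 * #|E k :&: E l| = #|E k|)%N ->
  forall k l, 2 * #|E k :&: E l|%:R / #|E k|%:R = (k == l).+1%:R :> R.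
Proof.
move=> E_gt0 EI k l; have E_neq0 : #|E k|%:R != 0 :> R.
  by rewrite pnatr_eq0 -lt0n.
have [<-|kl] := eqVneq k l; first by rewrite finset.setIid mulfK.
by rewrite -natrM EI// divff.
Qed.

(** The laws P k and Q k live on a half of the atoms and on its complement.  The
right-hand side (k == l).+1 is 2 if k = l and 1 otherwise, the latter expressing
the independence of distinct halves. *)
Lemma halves_exist (R : realType) (m : nat) :
  exists (U : probability R R) (P Q : 'I_m -> probability R R) (A : 'I_m -> set R),
    [/\ forall k, measurable (A k),
       forall k, has_density (P k) U (fun x => 2 * \1_(A k) x),
       forall k, has_density (Q k) U (fun x => 2 * \1_(~` A k) x),
       forall k l, (\int[P k]_x (2 * \1_(A l) x)%:E = (k == l).+1%:R%:E)%E &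
       forall k l, (\int[Q k]_x (2 * \1_(~` A l) x)%:E = (k == l).+1%:R%:E)%E].
Proof.
pose e (S : {set 'I_m}) : R := (enum_rank S)%:R.
have e_inj : injective e.
  by move=> S S' /eqP; rewrite eqr_nat => /eqP/val_inj/enum_rank_inj.
pose A k := e @` [set S | S \in avoiding k].
have Ae k S : A k (e S) <-> S \in avoiding k.
  by split=> [[S' + /e_inj <-]//|Sk]; exists S.
have ACe k S : (~` A k) (e S) <-> S \in ~: avoiding k.
  by rewrite inE; split=> [/(contra_not (Ae k S).2)/negP|/negP/(contra_not (Ae k S).1)].
have mA k : measurable (A k).
  apply: countable_measurable => //; apply: finite_set_countable.
  exact/finite_image/finite_finset.
have mAC k : measurable (~` A k) by exact: measurableC.
have I_gt0 : (0 < #|{set 'I_m}|)%N by apply/card_gt0P; exists finset.set0.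
have E_gt0 (k : 'I_m) : (0 < #|avoiding k|)%N by have := card_avoiding k; lia.
have EC_gt0 (k : 'I_m) : (0 < #|~: avoiding k|)%N by have := card_avoidingC k; lia.
have [|U UE] := @uniform_law_exists _ R R _ e finset.setT; first by rewrite cardsT.
have /choice[P PE] k := @uniform_law_exists _ R R _ e _ (E_gt0 k).
have /choice[Q QE] k := @uniform_law_exists _ R R _ e _ (EC_gt0 k).
exists U, P, Q, A; split=> // [k|k|k l|k l].
- by apply: has_density_uniform_law (PE k) UE => //; exact: card_avoiding.
- by apply: has_density_uniform_law (QE k) UE => //; exact: card_avoidingC.
- rewrite (integral_uniform_law_indic (mA l) (Ae l) (PE k)).
  by rewrite half_overlaps// => *; exact: card_avoidingI.
- rewrite (integral_uniform_law_indic (mAC l) (ACe l) (QE k)).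
  by rewrite (half_overlaps (E := fun k => ~: avoiding k))// => *; exact: card_avoidingCI.
Qed.

(** * From trade-off functions to the two errors *)

(** Under a single law, type I error at most a forces type II error at least
1 - a, and f <= 1 - a. *)
Lemma tradeoff_refl {R : realType} (U : probability R R) (f : R -> R) :
  is_tradeoff f -> dominates (tradeoff U U) (EFin \o f).
Proof.
move=> [_ _ _ _ f_le] a a01; apply: le_ereal_inf_tmp => _ [phi [tphi phia] <-].
rewrite !unlock in phia *.
rewrite (@le_trans _ _ (1 - a)%:E)//; first by rewrite lee_fin f_le.
by rewrite EFinB leeBlDr// -(test_integral_compl U tphi) addeC leeD2l.
Qed.

(** The indicator of the complement of A rejects with probability 0 under P and
with probability 1 under Q. *)
Lemma tradeoff0_le0 {R : realType} {P Q U : probability R R} {A : set R} :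
  measurable A ->
  has_density P U (fun x => 2 * \1_A x) ->
  has_density Q U (fun x => 2 * \1_(~` A) x) ->
  (tradeoff P Q 0 <= 0)%E.
Proof.
move=> mA [_ _ PE] [_ _ QE].
have tphi : is_test (\1_(~` A) : R -> R).
  split; first exact/measurable_indic/measurableC.
  by move=> x; rewrite indicE; case: (_ \in _); rewrite /= ?lexx ?ler01.
have [mphi phi01] := tphi; have [mphiC phiC01] := test_compl tphi.
apply: ereal_inf_lbound; exists (\1_(~` A)); last first.
  rewrite unlock QE; last 2 first.
  - exact/measurable_EFinP.
  - by move=> x; rewrite lee_fin; case/andP: (phiC01 x).
  apply: integral0_eq => x _; rewrite -EFinM indicE.
  by case: (_ \in _); rewrite /= ?subrr ?mulr0// mul0r.
split=> //; rewrite unlock PE; last 2 first.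
- exact/measurable_EFinP.
- by move=> x; rewrite lee_fin; case/andP: (phi01 x).
rewrite integral0_eq// => x _; rewrite -EFinM indicC indicE.
by case: (_ \in _); rewrite /= ?mulr0// mul0r.
Qed.

(** The number m of alternatives is chosen only after n and eps: the error of
the second moment bound with delta = eps / 2 is then eps / 2 + 4^n / (2 m eps),
at most eps as soon as m >= 4^n / eps^2. *)
Lemma null_close_to_alternatives {R : realType} (n : nat)
    (phi : n.-tuple R * n.-tuple R -> R) (b eps : R) :
  is_test phi -> 0 < eps ->
  (forall P Q : probability R R, (tradeoff P Q 0 <= 0)%E ->
    (\int[iid P n \x iid Q n]_z (phi z)%:E <= b%:E)%E) ->
  exists U : probability R R,
    (\int[iid U n \x iid U n]_z (phi z)%:E <= (b + eps)%:E)%E.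
Proof.
move=> tphi eps_gt0 phib.
pose C : R := 4 ^+ n.
pose m := (Num.truncn (C / eps ^+ 2)).+1.
have [U [P [Q [A [mA dP dQ PA QA]]]]] := halves_exist R m.
exists U.
pose V : probability _ R := (iid U n \x iid U n)%E.
pose W k : probability _ R := (iid (P k) n \x iid (Q k) n)%E.
pose L k (z : n.-tuple R * n.-tuple R) : R :=
  (\prod_(i < n) (2 * \1_(A k) (tnth z.1 i))) *
  (\prod_(i < n) (2 * \1_(~` A k) (tnth z.2 i))).
have dW k : has_density (W k) V (L k).
  exact: has_density_prod (has_density_iid _ (dP k)) (has_density_iid _ (dQ k)).
have WL k l : (\int[W k]_z (L l z)%:E = ((k == l).+1%:R ^+ n * (k == l).+1%:R ^+ n)%:E)%E.
  have [mg g_ge0 _] := dP l; have [mh h_ge0 _] := dQ l.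
  apply: (integral_prodM (measurable_tuple_prod _ _ mg) (measurable_tuple_prod _ _ mh)).
  - by move=> t; rewrite prodr_ge0.
  - by move=> t; rewrite prodr_ge0.
  - exact: integral_iid_prod mg g_ge0 (PA k l).
  - exact: integral_iid_prod mh h_ge0 (QA k l).
have := @second_moment_bound _ _ _ m V W L dW C phi b (eps / 2).
have C_ge0 : 0 <= C by rewrite exprn_ge0.
move=> /(_ isT _ C_ge0) bound.
apply: (le_trans (bound _ _ _ tphi _)).
- by rewrite divr_gt0.
- by move=> k l kl; rewrite WL (negbTE kl) expr1n mulr1.
- by move=> k; rewrite WL eqxx -exprMn -natrM.
- by move=> k; apply: phib; exact: tradeoff0_le0 (mA k) (dP k) (dQ k).
rewrite lee_fin -addrA lerD2l.
have m_gt : C / eps ^+ 2 < m%:R by exact: truncnS_gt.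
have m_gt0 : 0 < m%:R :> R by rewrite ltr0n.
rewrite ltr_pdivrMr ?exprn_gt0// in m_gt.
suff : C / (4 * m%:R * (eps / 2)) <= eps / 2 by lra.
rewrite ler_pdivrMr; first nra.
by rewrite !mulr_gt0// invr_gt0.
Qed.

Theorem corollary2p1 (R : realType) (f0 f1 : R -> R)
    (hf0 : is_tradeoff f0) (hf1 : is_tradeoff f1) (hf1_gt0 : 0 < f1 0)
    (n : nat) (hn : (1 <= n)%N)
    (psi : n.-tuple R * n.-tuple R -> R) (hpsi : is_test psi) :
  (1 <= ErrI f0 [set: probability R R * probability R R] psi
        + ErrII f1 [set: probability R R * probability R R] psi)%E.
Proof.
have tpsi := test_compl hpsi.
have ErrII_ge (P Q : probability R R) : (tradeoff P Q 0 <= 0)%E ->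
  (\int[iid P n \x iid Q n]_z (1 - psi z)%:E <= ErrII f1 setT psi)%E.
  move=> PQ0; apply: ereal_sup_ubound; exists (P, Q); last by rewrite unlock.
  split=> //; exists 0; first by rewrite in_itv/= lexx ler01.
  by rewrite (le_lt_trans PQ0)// lte_fin.
have ErrI_ge (U : probability R R) :
  (\int[iid U n \x iid U n]_z (psi z)%:E <= ErrI f0 setT psi)%E.
  apply: ereal_sup_ubound; exists (U, U); last by rewrite unlock.
  by split=> //; exact: tradeoff_refl.
have ErrII_ge0 : (0 <= ErrII f1 setT psi)%E.
  have [U [P [Q [A [mA dP dQ _ _]]]]] := halves_exist R 1.
  have PQ0 := tradeoff0_le0 (mA ord0) (dP ord0) (dQ ord0).
  exact: le_trans (test_integral_ge0 _ tpsi) (ErrII_ge _ _ PQ0).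
have ErrII_le1 : (ErrII f1 setT psi <= 1)%E.
  apply: ge_ereal_sup => _ [PQ _ <-]; rewrite unlock.
  exact: test_integral_le1.
have ErrII_fin : ErrII f1 setT psi \is a fin_num.
  by rewrite ge0_fin_numE// (le_lt_trans ErrII_le1)// ltry.
apply/lee_addgt0Pr => eps eps_gt0.
have [P Q PQ0|U] := @null_close_to_alternatives R n (fun z => 1 - psi z)
  (fine (ErrII f1 setT psi)) eps tpsi eps_gt0.
  by rewrite fineK// ErrII_ge.
rewrite EFinD fineK// => psiU.
rewrite -addeA -(test_integral_compl (iid U n \x iid U n)%E hpsi).
exact: (leeD (ErrI_ge U) psiU).
Qed.
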